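(* The inequality $$w\le\sum_{i\in S_0}\zeta(a_i)x_i+\sum_{i\in S_1}\eta^U(-a_i)(\mu_i-x_i)+\rho_s(k)(x_s-k)+g(ka_s)$$ is valid for $\mathcal{X}$. It is facet-defining for $\operatorname{conv}(\mathcal{X})$ if $$(k-\mu_s-1)a_s-\sum_{j\in S_0^+}\mu_ja_j\le -a_i\le 0\quad\text{for all } i\in S_1.$$
   Context: Let $n\ge 1$, let $f:\mathbb{R}\to\mathbb{R}$ be concave, let $a\in\mathbb{R}^n$ with $a_i\ge 0$ for all $i$, and let $\mu\in\mathbb{Z}^n$ with all $\mu_i\ge 1$. Define $$\mathcal{X}=\{(w,x)\in\mathbb{R}\times\mathbb{Z}^n : w\le f(a^\top x),\ 0\le x_i\le\mu_i\ \text{for } i=1,\dots,n\}.$$ Fix $s\in\{1,\dots,n\}$ with $a_s>0$, disjoint subsets $S_0,S_1$ of $\{1,\dots,n\}\setminus\{s\}$ with $\{s\}\cup S_0\cup S_1=\{1,\dots,n\}$, and an integer $k\in\{1,\dots,\mu_s\}$. Define $g(z)=f\big(z+\sum_{i\in S_1}\mu_i a_i\big)$, $\rho_s(k)=g(ka_s)-g((k-1)a_s)$, $$\zeta(\delta)=\max\big\{g(\delta+a_s x)-\rho_s(k)(x-k)-g(ka_s) : x\in\mathbb{Z},\ 0\le x\le\mu_s\big\}\quad(\delta\in\mathbb{R}),$$ $S_0^+=\{i\in S_0 : a_i\ge ka_s\}$, and, for $\delta\le 0$, $$\eta^U(\delta)=\max\Big\{g\Big(\delta+\sum_{i\in S_0\cup\{s\}}a_ix_i\Big)-\sum_{i\in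 S_0}\zeta(a_i)x_i+(k-x_s)\rho_s(k)-g(ka_s) : x_i\in\mathbb{Z}\ \forall\, i\in S_0\cup\{s\},\ 0\le x_i\le\mu_i\ \forall\, i\in S_0,\ x_s\ge 0\Big\}.$$ An inequality is valid for a set if all points of the set satisfy it; it is facet-defining for a polyhedron $P$ if it is valid for $P$ and the set of points of $P$ satisfying it with equality is a face of dimension $\dim P-1$. *)

(* Defs.v *)
From HB Require Import structures.
From mathcomp Require Import all_boot all_order all_algebra.
From mathcomp Require Import all_classical all_reals all_analysis.

Set Implicit Arguments.
Unset Strict Implicit.
Unset Printing Implicit Defensive.

Import Order.TTheory GRing.Theory Num.Theory.
Local Open Scope classical_set_scope.
Local Open Scope ring_scope.

Definition concave_function (R : realType) (f : R -> R) : Prop :=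
  convex_function (setT : set (convex_lmodType R^o)) (fun z => - f z).

Definition conv_hull (R : realType) (V : lmodType R) (A : set V) : set V :=
  smallest (@convex_set R V) A.

Definition affinely_independent (R : realType) (V : lmodType R) (r : nat)
    (t : r.-tuple V) : Prop :=
  forall c : 'I_r -> R,
    \sum_i c i = 0 -> \sum_i c i *: tnth t i = 0 -> forall i, c i = 0.

(* One less than the maximal number of affinely independent points of A, which
   is at most \dim {: V} + 1; in particular affdim set0 = -1. *)
Definition affdim (R : realType) (V : vectType R) (A : set V) : int :=
  (\max_(r < (\dim {: V}).+2 | `[< exists t : r.-tuple V,
      affinely_independent t /\ forall i, A (tnth t i) >]) r)%N%:Z - 1.

(* An inequality l p <= r p on V is represented by its two sides l and r. *)
Definition valid_ineq (R : realType) (V : Type) (l r : V -> R) (A : set V) :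
    Prop :=
  forall p, A p -> l p <= r p.

Definition facet_defining (R : realType) (V : vectType R) (l r : V -> R)
    (P : set V) : Prop :=
  valid_ineq l r P /\ affdim (P `&` [set p | l p = r p]) = affdim P - 1.

(* The greatest element of A, with junk value 0 if there is none. *)
Definition maximum (R : realType) (A : set R) : R :=
  xget 0 [set m | A m /\ ubound A m].

Lemma maximum_eq (R : realType) (A : set R) (m : R) :
  A m -> ubound A m -> maximum A = m.
Proof.
move=> Am ubm; apply: xget_unique => // y [Ay uby].
by apply/eqP; rewrite eq_le ubm // uby.
Qed.

(* The ambient space of the points (w, x). *)
Definition wx_space (R : realType) (n : nat) : Type := (R^o * 'rV[R]_n)%type.

Definition calX (R : realType) (n : nat) (f : R -> R) (a : 'rV[R]_n)
    (mu : 'rV[int]_n) : set (wx_space R n) :=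
  [set p : wx_space R n | [/\ p.1 <= f (\sum_i a 0 i * p.2 0 i),
               forall i, p.2 0 i \is a Num.int
             & forall i, 0 <= p.2 0 i <= (mu 0 i)%:~R]].

Definition gfun (R : realType) (n : nat) (f : R -> R) (a : 'rV[R]_n)
    (mu : 'rV[int]_n) (S1 : {set 'I_n}) (z : R) : R :=
  f (z + \sum_(i in S1) (mu 0 i)%:~R * a 0 i).

Definition rho (R : realType) (n : nat) (f : R -> R) (a : 'rV[R]_n)
    (mu : 'rV[int]_n) (s : 'I_n) (S1 : {set 'I_n}) (k : int) : R :=
  gfun f a mu S1 (k%:~R * a 0 s) - gfun f a mu S1 ((k - 1)%:~R * a 0 s).

Definition zeta (R : realType) (n : nat) (f : R -> R) (a : 'rV[R]_n)
    (mu : 'rV[int]_n) (s : 'I_n) (S1 : {set 'I_n}) (k : int) (delta : R) : R :=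
  maximum [set gfun f a mu S1 (delta + a 0 s * x%:~R)
               - rho f a mu s S1 k * (x - k)%:~R
               - gfun f a mu S1 (k%:~R * a 0 s)
          | x in [set x : int | 0 <= x <= mu 0 s]].

Definition S0plus (R : realType) (n : nat) (a : 'rV[R]_n) (s : 'I_n)
    (S0 : {set 'I_n}) (k : int) : {set 'I_n} :=
  [set i in S0 | k%:~R * a 0 s <= a 0 i].

(* The integer vector x is indexed by all of 'I_n, but its coordinates outside
   S0 and s are neither constrained nor used.  Although x_s is not bounded
   above, the maximum is attained: f being concave, increasing x_s by 1 adds
   g (y + a_s) - g y - rho <= 0 as soon as y >= (k - 1) a_s. *)
Definition etaU (R : realType) (n : nat) (f : R -> R) (a : 'rV[R]_n)
    (mu : 'rV[int]_n) (s : 'I_n) (S0 S1 : {set 'I_n}) (k : int) (delta : R) :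
    R :=
  maximum [set gfun f a mu S1 (delta + \sum_(i in s |: S0) a 0 i * (x 0 i)%:~R)
               - \sum_(i in S0) zeta f a mu s S1 k (a 0 i) * (x 0 i)%:~R
               + (k - x 0 s)%:~R * rho f a mu s S1 k
               - gfun f a mu S1 (k%:~R * a 0 s)
          | x in [set x : 'rV[int]_n |
                   (forall i, i \in S0 -> 0 <= x 0 i <= mu 0 i) /\ 0 <= x 0 s]].

Definition lifted_rhs (R : realType) (n : nat) (f : R -> R) (a : 'rV[R]_n)
    (mu : 'rV[int]_n) (s : 'I_n) (S0 S1 : {set 'I_n}) (k : int)
    (x : 'rV[R]_n) : R :=
  \sum_(i in S0) zeta f a mu s S1 k (a 0 i) * x 0 i
  + \sum_(i in S1) etaU f a mu s S0 S1 k (- a 0 i) * ((mu 0 i)%:~R - x 0 i)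
  + rho f a mu s S1 k * (x 0 s - k%:~R)
  + gfun f a mu S1 (k%:~R * a 0 s).

(* Main.v *)
(* With c = a_s and K = k c, subtract from g the line through its values at
   K - c and K: the result G is concave and vanishes at both points, hence is
   nonnegative between them and nonpositive outside.  Writing
   Z d = max_(j >= 0) G (d + c j), one gets, up to the linear term
   rho / c * d, zeta = Z on d >= 0 and etaU d =
   max_x [Z (d + sum a_i x_i) - sum Z (a_i) x_i], x ranging over the box on S0.
   Z is c-periodic below K and equal to G above K, which makes it subadditive on
   [0, +oo[ and on ]-oo, K].  Validity follows from the subadditivity of etaU on
   ]-oo, 0]: an optimal x for d + e is split greedily between d and e, except
   that at the critical item both sides may have to use the same copy.
   For the facet, adding an item with a_i >= K to x while d + sum a_i x_i <= 0
   does not decrease the objective, so under the size condition the optimum is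
   attained with x_s <= mu_s; this gives n + 1 tight vertices, which form a
   triangular and hence affinely independent family. *)
Require Import Defs.
From HB Require Import structures.
From mathcomp Require Import all_boot all_order all_algebra.
From mathcomp Require Import all_classical all_reals all_analysis.
From mathcomp Require Import ring lra zify.

Import Order.TTheory GRing.Theory Num.Theory.
Local Open Scope classical_set_scope.
Local Open Scope ring_scope.

(** * Concavity on the real line in a division-free form *)

Definition concave_on_line {R : realType} (G : R -> R) : Prop :=
  forall x y z, x <= y <= z -> (z - y) * G x + (y - x) * G z <= (z - x) * G y.

(** [q] and [r] are convex combinations of [p] and [t] with swapped weights, so their two concavity
    inequalities add up to [t - p] times the claim. *)
Lemma concave_on_line_exchange {R : realType} {G : R -> R} (p q r t : R) :
  concave_on_line G -> p <= q -> p <= r -> p + t = q + r ->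
  G p + G t <= G q + G r.
Proof.
move=> Gconc pq pr ptqr.
have [ptE|ptn] := eqVneq p t.
  by have [-> ->] : q = p /\ r = t by split; lra.
have pt : 0 < t - p by rewrite subr_gt0 lt_neqAle ptn /=; lra.
have Hq := Gconc p q t; have Hr := Gconc p r t.
rewrite -(ler_pM2l pt) !mulrDr.
have {}Hq := Hq ltac:(lra); have {}Hr := Hr ltac:(lra).
have [trE rpE] : t - r = q - p /\ r - p = t - q by split; lra.
by rewrite trE rpE in Hr; lra.
Qed.

(** * The envelope of [G] under forward shifts by multiples of [c] *)

Section PeriodicEnvelope.

Context {R : realType}.
Variables (G : R -> R) (c K : R).

(** The largest number of steps that does not carry [d] beyond [K], cut off at 0. For [d <= K] it
    lands in the window from [K - c] to [K]. *)
Definition lift_steps (d : R) : int := Num.max 0 (Num.floor ((K - d) / c)).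

(** Closed form of the maximum of [G (d + c * j)] over integers [j >= 0]; [envelope_max] shows that
    no [j] does better. *)
Definition step_envelope (d : R) : R := G (d + c * (lift_steps d)%:~R).

Local Notation Z := step_envelope.

Hypothesis c_gt0 : 0 < c.
Hypothesis c_le_K : c <= K.
Hypothesis Gconc : concave_on_line G.
Hypothesis GK : G K = 0.
Hypothesis GKc : G (K - c) = 0.

Lemma envelope_steps_le (d : R) : d <= K ->
  exists j : int, [/\ 0 <= j, K - c <= d + c * j%:~R <= K
                    & Z d = G (d + c * j%:~R)].
Proof.
move=> dK; exists (lift_steps d).
have E : lift_steps d = Num.floor ((K - d) / c).
  by rewrite /lift_steps max_r // floor_ge0 divr_ge0 ?subr_ge0 // ltW.
split=> //; first by rewrite le_max lexx.
have /andP[] := floor_itv ((K - d) / c).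
rewrite ler_pdivlMr // ltr_pdivrMr // E intrD => *; lra.
Qed.

Lemma envelope_ge (d : R) : K <= d -> Z d = G d.
Proof.
have c0 := c_gt0.
move=> Kd.
suff E : lift_steps d = 0 by rewrite /step_envelope E mulr0 addr0.
apply/max_l; rewrite -ltzD1 add0r -(ltr_int R).
apply: le_lt_trans (floor_le _) _.
by rewrite ltr_pdivrMr // mul1r; lra.
Qed.

Lemma concave_ge0_between (t : R) : K - c <= t <= K -> 0 <= G t.
Proof.
move=> ht; have c0 : 0 < K - (K - c) by have := c_gt0; lra.
by have := Gconc _ _ _ ht; rewrite GK GKc !mulr0 addr0 pmulr_rge0.
Qed.

Lemma concave_le0_after (t : R) : K <= t -> G t <= 0.
Proof.
have c0 := c_gt0.
move=> ht; have /Gconc : K - c <= K <= t by apply/andP; split=> //; lra.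
by rewrite GK GKc !mulr0 add0r pmulr_rle0 //; lra.
Qed.

Lemma concave_le0_before (t : R) : t <= K - c -> G t <= 0.
Proof.
have c0 := c_gt0.
move=> ht; have /Gconc : t <= K - c <= K by apply/andP; split=> //; lra.
by rewrite GK GKc !mulr0 addr0 pmulr_rle0 //; lra.
Qed.

(** If [G] rose from [t > K] to [u], then, [G t] being at most 0, the graph at [t] would lie below
    the chord over [K] and [u]. *)
Lemma concave_nonincreasing_after (t u : R) : K <= t <= u -> G u <= G t.
Proof.
move=> htu; have := Gconc K t u; rewrite GK => H; have {}H := H htu.
have := concave_le0_after t; have : K <= t by lra.
move=> Kt /(_ Kt) Gt; rewrite leNgt; apply/negP => tu.
have : (u - K) * G t < (t - K) * G u -> False by move=> ?; lra.
apply.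
have [utn|tun] := eqVneq t u; first by rewrite utn ltxx in tu.
have ltu : 0 < u - t by rewrite subr_gt0 lt_neqAle tun; lra.
have [KtE|Ktn] := eqVneq K t.
  by rewrite -KtE GK in tu *; have := concave_le0_after u; lra.
have : 0 < t - K by rewrite subr_gt0 lt_neqAle Ktn.
nra.
Qed.

(** A shift by a nonzero multiple of [c] leads out of the open window, hence to a value at most 0,
    while [G t] is nonnegative. *)
Lemma concave_max_between (t : R) (i : int) :
  K - c <= t <= K -> G (t + c * i%:~R) <= G t.
Proof.
move=> ht; have G0 := concave_ge0_between _ ht.
have [i0|i0] := lerP i (-1); last have [->|i1] : i = 0 \/ 1 <= i by lia.
- apply: le_trans G0; apply: concave_le0_before.
  have : i%:~R <= -1 :> R by rewrite -[-1]/((-1)%:~R) ler_int.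
  nra.
- by rewrite mulr0 addr0.
- apply: le_trans G0; apply: concave_le0_after.
  have : 1 <= i%:~R :> R by rewrite -[1]/(1%:~R) ler_int.
  nra.
Qed.

Lemma envelope_max_le (d : R) (i : int) :
  d <= K -> G (d + c * i%:~R) <= Z d.
Proof.
move=> /envelope_steps_le[j [_ hj ->]].
have -> : d + c * i%:~R = (d + c * j%:~R) + c * (i - j)%:~R by rewrite intrB; lra.
by apply: concave_max_between.
Qed.

Lemma envelope_max (d : R) (i : int) : 0 <= i -> G (d + c * i%:~R) <= Z d.
Proof.
have c0 := c_gt0.
move=> i0; have [dK|Kd] := lerP d K; first exact: envelope_max_le.
rewrite (envelope_ge d (ltW Kd)); apply: concave_nonincreasing_after.
have : 0 <= i%:~R :> R by rewrite -[0]/(0%:~R) ler_int.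
nra.
Qed.

(** An upper bound on [Z d] needs only one representative of [d] modulo [c] in the window. This
    includes [d > K], where [Z d = G d] is nonpositive. *)
Lemma envelope_le_periodic (d : R) (i : int) :
  K - c <= d + c * i%:~R <= K -> Z d <= G (d + c * i%:~R).
Proof.
move=> hi; have := concave_ge0_between _ hi.
have [dK _|Kd G0] := lerP d K; last first.
  by rewrite (envelope_ge d (ltW Kd)); apply: le_trans G0; apply/concave_le0_after/ltW.
have [j [_ _ ->]] := envelope_steps_le _ dK.
have -> : d + c * j%:~R = (d + c * i%:~R) + c * (j - i)%:~R by rewrite intrB; lra.
exact: concave_max_between.
Qed.

Lemma envelope_ge0 (d : R) : d <= K -> 0 <= Z d.
Proof. by move=> /envelope_steps_le[j [_ hj ->]]; apply: concave_ge0_between. Qed.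

(** * Subadditivity and exchange inequalities when [K] is a multiple of [c] *)

Variable k : int.
Hypothesis KE : K = c * k%:~R.

Lemma concave_le0_multiple (i : int) : G (c * i%:~R) <= 0.
Proof.
have c0 := c_gt0.
have -> : c * i%:~R = K + c * (i - k)%:~R by rewrite intrB KE; lra.
by rewrite -GK; apply: concave_max_between; apply/andP; split; lra.
Qed.

Lemma envelope0 : step_envelope 0 = 0.
Proof.
have c0 := c_gt0; have cK := c_le_K.
apply/eqP; rewrite eq_le envelope_ge0 ?andbT; last by lra.
have := envelope_le_periodic 0 k; rewrite add0r -KE GK; apply.
by apply/andP; split; lra.
Qed.

(** Let [s] and [t] represent [A] and [B] in the window. One of [s + t - (K - c)] and [s + t - K]
    lies in the window and, [K] being a multiple of [c], represents [A + B]. Concave exchange with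
    the zero of [G] at [K - c] or at [K] concludes. *)
Lemma envelope_subadditive_le (A B : R) :
  A <= K -> B <= K -> Z (A + B) <= Z A + Z B.
Proof.
move=> /envelope_steps_le[i [_ hi ->]] /envelope_steps_le[j [_ hj ->]].
set s := A + _ in hi *; set t := B + _ in hj *.
have sE : A = s - c * i%:~R by rewrite /s; lra.
have tE : B = t - c * j%:~R by rewrite /t; lra.
have [stK|Kst] := lerP (s + t - (K - c)) K.
- apply: (le_trans (envelope_le_periodic _ (i + j - (k - 1)) _));
    have E : A + B + c * (i + j - (k - 1))%:~R = s + t - (K - c)
      by rewrite !intrB intrD sE tE KE; lra.
    by rewrite E; lra.
  rewrite E.
  have := concave_on_line_exchange (K - c) s t (s + t - (K - c)) Gconc.
  rewrite GKc => H; have {}H := H ltac:(lra) ltac:(lra) ltac:(lra); lra.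
- apply: (le_trans (envelope_le_periodic _ (i + j - k) _));
    have E : A + B + c * (i + j - k)%:~R = s + t - K
      by rewrite intrB intrD sE tE KE; lra.
    by rewrite E; lra.
  rewrite E.
  have := concave_on_line_exchange (s + t - K) s t K Gconc.
  rewrite GK => H; have {}H := H ltac:(lra) ltac:(lra) ltac:(lra); lra.
Qed.

(** If only the larger argument exceeds [K], then [Z (A + B) <= Z A] by monotonicity and [Z B] is
    nonnegative. If both do, exchange with the zero at [K] applies. *)
Lemma envelope_subadditive_ge0 (A B : R) :
  0 <= A -> 0 <= B -> Z (A + B) <= Z A + Z B.
Proof.
have c0 := c_gt0; have cK := c_le_K.
wlog BA : A B / B <= A.
  move=> H A0 B0; have [/H|/ltW/H] := lerP B A; first by apply.
  by rewrite (addrC A) (addrC (Z A)); apply.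
move=> A0 B0; have [AK|KA] := lerP A K.
  by apply: envelope_subadditive_le => //; lra.
rewrite (envelope_ge A (ltW KA)) (@envelope_ge (A + B)); last by lra.
have [BK|KB] := lerP B K.
  have := concave_nonincreasing_after A (A + B); have := envelope_ge0 _ BK.
  move=> ? H; have {}H := H ltac:(lra); lra.
rewrite (envelope_ge B (ltW KB)).
have := concave_on_line_exchange K A B (A + B - K) Gconc.
have := concave_nonincreasing_after (A + B - K) (A + B).
rewrite GK => H1 H2; have {}H1 := H1 ltac:(lra).
have {}H2 := H2 ltac:(lra) ltac:(lra) ltac:(lra); lra.
Qed.

(** Serves the case where one item [b] is used on both sides. If [A + B + b] has to be lifted by
    [c * j], this amount is taken from [b]: since [b - c * j] is still at least [K], where [G] is
    nonincreasing, concave exchange remains available. *)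
Lemma envelope_exchange (A B b : R) :
  A <= 0 -> B <= 0 -> K <= A + b -> K <= B + b ->
  Z (A + B + b) + Z b <= Z (A + b) + Z (B + b).
Proof.
move=> A0 B0 KA KB; rewrite !(@envelope_ge _ KA, @envelope_ge _ KB).
rewrite (@envelope_ge b); last by lra.
have [ABK|KAB] := lerP (A + B + b) K; last first.
  rewrite (envelope_ge _ (ltW KAB)).
  by apply: concave_on_line_exchange => //; lra.
have [j [j0 hj ->]] := envelope_steps_le _ ABK.
set t := A + B + b + _ in hj *.
have tE : t = A + B + b + c * j%:~R by [].
have : 0 <= j%:~R :> R by rewrite -[0]/(0%:~R) ler_int.
rewrite -(pmulr_rge0 _ c_gt0) => cj.
have := concave_nonincreasing_after (b - c * j%:~R) b.
move=> H1; have {}H1 := H1 ltac:(lra).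
have := concave_on_line_exchange t (A + b) (B + b) (b - c * j%:~R) Gconc.
move=> H2; have {}H2 := H2 ltac:(lra) ltac:(lra) ltac:(lra); lra.
Qed.

(** The lifted [- b] and [b] add up to [c * j = K + c * (j - k)], a sum of two multiples of [c], at
    which [G] is at most 0. *)
Lemma envelope_large_opp_le0 (b : R) : K <= b -> Z (- b) + Z b <= 0.
Proof.
have c0 := c_gt0; have cK := c_le_K.
move=> Kb; rewrite (envelope_ge b)//.
have [j [j0 /andP[hj1 hj2] ->]] := envelope_steps_le (- b) ltac:(lra).
have := @concave_on_line_exchange _ _ (- b + c * j%:~R) K (c * (j - k)%:~R) b Gconc.
rewrite GK intrB -intrB => H; have {}H := H ltac:(lra).
have E : c * (j - k)%:~R = c * j%:~R - K by rewrite intrB KE; lra.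
have {}H := H ltac:(lra) ltac:(lra).
by have := concave_le0_multiple (j - k); lra.
Qed.

(** Reverses subadditivity, so that adding an item of size at least [K] at a nonpositive argument
    loses nothing. Below [K], write [T] as [(T + b) + (- b)]; above, exchange [T + c * j] and [b]
    for [T + b] and [c * j]. *)
Lemma envelope_add_large (T b : R) :
  T <= 0 -> K <= b -> Z T + Z b <= Z (T + b).
Proof.
have c0 := c_gt0; have cK := c_le_K.
move=> T0 Kb; have [TbK|KTb] := lerP (T + b) K.
  have := envelope_subadditive_le (T + b) (- b) TbK ltac:(lra).
  by rewrite addrK; have := envelope_large_opp_le0 b Kb; lra.
have [->|T_neq0] := eqVneq T 0; first by rewrite envelope0 !add0r.
rewrite (envelope_ge b Kb) (envelope_ge (T + b) (ltW KTb)).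
have [j [j0 /andP[hj1 hj2] ->]] := envelope_steps_le T ltac:(lra).
have jk : k <= j.
  rewrite -(ler_int R) -(ler_pM2l c0) -KE leNgt; apply/negP => jK.
  have : j <= k - 1.
    suff : j < k by lia.
    by rewrite -(ltr_int R) -(ltr_pM2l c0) -KE.
  rewrite -(ler_int R) -(ler_pM2l c0) intrB mulrBr mulr1 -KE => jKc.
  by move/eqP: T_neq0; apply; lra.
rewrite -(ler_int R) -(ler_pM2l c0) -KE in jk.
have := concave_on_line_exchange (T + c * j%:~R) (T + b) (c * j%:~R) b Gconc.
move=> H; have {}H := H ltac:(lra) ltac:(lra) ltac:(lra).
by have := concave_le0_multiple j; lra.
Qed.

(** The step count can exceed [M] only by one, and then it lands exactly on [K]; stopping one step
    earlier, at [K - c], gives the same value 0. *)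
Lemma envelope_steps_bounded (T : R) (M : int) :
  0 <= M -> K - c - c * M%:~R <= T ->
  exists2 j : int, 0 <= j <= M & Z T = G (T + c * j%:~R).
Proof.
have c0 := c_gt0.
move=> M0 hT; have [TK|KT] := lerP T K; last first.
  by exists 0; rewrite ?lexx // mulr0 addr0 (envelope_ge _ (ltW KT)).
have [j [j0 /andP[hj1 hj2] ->]] := envelope_steps_le T TK.
have [jM|Mj] := lerP j M; first by exists j; rewrite ?j0.
have jE : j = M + 1.
  suff : j <= M + 1 by lia.
  by rewrite -(ler_int R) -(ler_pM2l c0) intrD; lra.
exists M; rewrite ?M0 ?lexx //.
have cjE : c * j%:~R = c * M%:~R + c by rewrite jE intrD; lra.
have -> : T + c * M%:~R = K - c by lra.
have -> : T + c * j%:~R = K by lra.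
by rewrite GK GKc.
Qed.

(** * Packing copies of items against the envelope *)

Section LiftedValue.

Context {I : finType}.
Variables (S : {set I}) (a : I -> R).
Hypothesis a_ge0 : forall i, 0 <= a i.

Definition total_load (x : I -> nat) : R := \sum_(i in S) a i * (x i)%:R.

Definition lifting_cost (x : I -> nat) : R := \sum_(i in S) Z (a i) * (x i)%:R.

(** The objective of [etaU] after maximising over x_s, which turns [G] into [Z], and without its
    term linear in [d]. *)
Definition lifted_value (d : R) (x : I -> nat) : R :=
  Z (d + total_load x) - lifting_cost x.

Definition incr_at (x : I -> nat) (i : I) : I -> nat := fun j => (x j + (j == i))%N.

Lemma sum_incr_at (b : I -> R) (x : I -> nat) (i : I) : i \in S ->
  \sum_(j in S) b j * (incr_at x i j)%:R = \sum_(j in S) b j * (x j)%:R + b i.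
Proof.
move=> iS; rewrite (bigD1 i)//= [in RHS](bigD1 i)//= /incr_at eqxx addn1 -natr1.
rewrite (eq_bigr (fun j => b j * (x j)%:R)); last first.
  by move=> j /andP[_ /negbTE ->]; rewrite addn0.
by rewrite mulrDr mulr1 addrAC.
Qed.

Lemma sum_subn (b : I -> R) (x y : I -> nat) :
  (forall i, i \in S -> (y i <= x i)%N) ->
  \sum_(j in S) b j * (x j - y j)%:R
    = \sum_(j in S) b j * (x j)%:R - \sum_(j in S) b j * (y j)%:R.
Proof.
move=> yx; rewrite -sumrB; apply: eq_bigr => j jS.
by rewrite natrB ?yx // mulrBr.
Qed.

Lemma incr_at_le (x y : I -> nat) (i : I) : (x i < y i)%N ->
  (forall j, j \in S -> (x j <= y j)%N) ->
  forall j, j \in S -> (incr_at x i j <= y j)%N.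
Proof.
move=> xyi xy j /xy xyj; rewrite /incr_at.
by case: eqP => [->|_]; rewrite ?addn1 ?addn0.
Qed.

Lemma gap_incr_at (x y : I -> nat) (i : I) (N : nat) : i \in S -> (x i < y i)%N ->
  (\sum_(j in S) (y j - x j) <= N.+1)%N ->
  (\sum_(j in S) (y j - incr_at x i j) <= N)%N.
Proof.
move=> iS xyi; rewrite (bigD1 i)//= [X in _ -> (X <= N)%N](bigD1 i)//=.
have -> : (\sum_(j in S | j != i) (y j - incr_at x i j) =
           \sum_(j in S | j != i) (y j - x j))%N.
  by apply: eq_bigr => j /andP[_ /negbTE ji]; rewrite /incr_at ji addn0.
rewrite /incr_at eqxx; lia.
Qed.

(* The load x' of d is increased greedily while it fits in -d.  At the first item
   i that no longer fits, i goes to d alone or, when both sides would exceed K,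
   to d and to e: nothing requires y + z <= x. *)
Lemma lifted_value_split (d e : R) (x x' : I -> nat) : d <= 0 -> e <= 0 ->
  (forall i, i \in S -> (x' i <= x i)%N) -> d + total_load x' <= 0 ->
  exists y z, [/\ forall i, i \in S -> (y i <= x i)%N,
                  forall i, i \in S -> (z i <= x i)%N
                & lifted_value (d + e) x <= lifted_value d y + lifted_value e z].
Proof.
have c0 := c_gt0; have cK := c_le_K.
move=> d0 e0; have [N] := ubnP (\sum_(i in S) (x i - x' i))%N.
elim: N x' => // N IHN x' gapN x'x dx'.
have [[i [iS x'xi dxi]]|stop] :=
    pselect (exists i, [/\ i \in S, (x' i < x i)%N & d + total_load x' + a i <= 0]).
  apply: (IHN (incr_at x' i)).
  - rewrite ltnS in gapN; case: N gapN {IHN} => [|N] gapN; last first.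
      by rewrite ltnS; exact: gap_incr_at.
    by move: gapN; rewrite (bigD1 i)//=; lia.
  - exact: incr_at_le.
  - by rewrite /total_load sum_incr_at // addrA.
pose r := fun i => (x i - x' i)%N.
have loadr : total_load r = total_load x - total_load x' by exact: sum_subn.
have costr : lifting_cost r = lifting_cost x - lifting_cost x' by exact: sum_subn.
have rx i : i \in S -> (r i <= x i)%N by rewrite leq_subr.
(* [r] is what [x'] leaves over. If it keeps [e] below [K], both arguments are at most [K] and no
   further item has to move. *)
have [rK|Kr] := lerP (e + total_load r) K.
  exists x', r; split => //; rewrite /lifted_value costr.
  have := envelope_subadditive_le (d + total_load x') (e + total_load r) ltac:(lra) rK.
  have -> : d + total_load x' + (e + total_load r) = d + e + total_load x by rewrite loadr; lra.
  lra.
have [i [iS x'xi]] : exists i, i \in S /\ (x' i < x i)%N.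
  apply: contrapT => /forallNP none; suff load0 : total_load r = 0 by lra.
  apply: big1 => i iS; have /not_andP[//|/negP] := none i.
  by rewrite -leqNgt -subn_eq0 /r => /eqP ->; rewrite mulr0.
have dxi : 0 < d + total_load x' + a i.
  by rewrite ltNge; apply/negP => ?; apply: stop; exists i.
pose y := incr_at x' i.
have yx : forall j, j \in S -> (y j <= x j)%N by exact: incr_at_le.
have loady : total_load y = total_load x' + a i by exact: sum_incr_at.
have costy : lifting_cost y = lifting_cost x' + Z (a i) by exact: sum_incr_at.
pose z := fun i => (x i - y i)%N.
have loadz : total_load z = total_load x - total_load y by exact: sum_subn.
have costz : lifting_cost z = lifting_cost x - lifting_cost y by exact: sum_subn.
have zx j : j \in S -> (z j <= x j)%N by rewrite leq_subr.
have sumE : d + total_load y + (e + total_load z) = d + e + total_load x by rewrite loadz; lra.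
(* With [i] given to [d], the argument on that side is positive; the sign of the other decides which
   subadditivity applies. *)
have [z_ge0|z_lt0] := lerP 0 (e + total_load z).
  exists y, z; split => //; rewrite /lifted_value costz.
  have := envelope_subadditive_ge0 (d + total_load y) (e + total_load z).
  by rewrite sumE => H; have {}H := H ltac:(lra) z_ge0; lra.
have [yK|Ky] := lerP (d + total_load y) K.
  exists y, z; split => //; rewrite /lifted_value costz.
  have := envelope_subadditive_le (d + total_load y) (e + total_load z) yK ltac:(lra).
  by rewrite sumE; lra.
(* Here [i] is counted in both [y] and [r]; the term [Z b] of the exchange inequality pays for the
   second copy. *)
exists y, r; split => //; rewrite /lifted_value costr costy.
have := envelope_exchange (d + total_load x') (e + total_load z) (a i) dx' ltac:(lra).
have -> : e + total_load z + a i = e + total_load r by rewrite loadz loady loadr; lra.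
have -> : d + total_load x' + (e + total_load z) + a i = d + e + total_load x.
  by rewrite loadz loady; lra.
have -> : d + total_load x' + a i = d + total_load y by rewrite loady; lra.
by move=> H; have {}H := H ltac:(lra) ltac:(lra); lra.
Qed.

(** Subadditivity on nonnegative arguments, first over the copies of one item and then over the
    items. *)
Lemma lifted_value0_le0 (x : I -> nat) : lifted_value 0 x <= 0.
Proof.
rewrite /lifted_value add0r subr_le0.
have mulZ i (n : nat) : 0 <= a i * n%:R /\ Z (a i * n%:R) <= Z (a i) * n%:R.
  elim: n => [|n [IH0 IHn]]; first by rewrite !mulr0 envelope0.
  rewrite -natr1 !mulrDr !mulr1; split; first by rewrite addr_ge0.
  by apply: le_trans (envelope_subadditive_ge0 _ _ _ _) _; rewrite ?lerD2r.
have : 0 <= total_load x /\ Z (total_load x) <= lifting_cost x.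
  apply: (big_ind2 (fun p q => 0 <= p /\ Z p <= q)); first by rewrite envelope0.
    move=> p q p' q' [p0 pq] [p'0 p'q']; split; first by rewrite addr_ge0.
    by apply: le_trans (envelope_subadditive_ge0 _ _ _ _) _; rewrite ?lerD.
  by move=> i _; exact: mulZ.
by case.
Qed.

(** Items of size at least [K] are added one by one while the argument is below [L <= 0], each
    without loss by [envelope_add_large]. If they ran out first, the load would already contain all
    of them and reach [L]. *)
Lemma lifted_value_grow (d L : R) (x m : I -> nat) : L <= 0 ->
  (forall i, i \in S -> (x i <= m i)%N) ->
  L <= d + \sum_(i in S | K <= a i) a i * (m i)%:R ->
  exists y, [/\ forall i, i \in S -> (y i <= m i)%N, L <= d + total_load y
              & lifted_value d x <= lifted_value d y].
Proof.
move=> L0 xm Lm; have [N] := ubnP (\sum_(i in S) (m i - x i))%N.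
elim: N x xm => // N IHN x xm gapN.
have [Lx|xL] := lerP L (d + total_load x); first by exists x.
have [i [iS Kai xmi]] : exists i, [/\ i \in S, K <= a i & (x i < m i)%N].
  apply: contrapT => /forallNP none.
  suff : \sum_(i in S | K <= a i) a i * (m i)%:R <= total_load x by lra.
  rewrite /total_load [leRHS](bigID (fun i => K <= a i))/=.
  rewrite -[leLHS]addr0; apply: lerD.
    apply: ler_sum => i /andP[iS Kai]; rewrite ler_wpM2l // ler_nat leqNgt.
    by apply/negP => xmi; apply: (none i).
  by apply: sumr_ge0 => i _; rewrite mulr_ge0.
have loady : total_load (incr_at x i) = total_load x + a i by exact: sum_incr_at.
have costy : lifting_cost (incr_at x i) = lifting_cost x + Z (a i) by exact: sum_incr_at.
have [||y [ym Ly xy]] := IHN (incr_at x i).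
- exact: incr_at_le.
- rewrite ltnS in gapN; case: N gapN {IHN} => [|N] gapN; last first.
    by rewrite ltnS; exact: gap_incr_at.
  by move: gapN; rewrite (bigD1 i)//=; lia.
exists y; split => //; apply: le_trans xy.
rewrite /lifted_value costy loady addrA.
by have := envelope_add_large (d + total_load x) (a i) ltac:(lra) Kai; lra.
Qed.

End LiftedValue.

End PeriodicEnvelope.

(** * [zeta] and [etaU] in terms of the envelope *)

Lemma concave_function_on_line {R : realType} {f : R -> R} :
  concave_function f -> concave_on_line f.
Proof.
move=> fconc x y z /andP[xy yz].
have [xz|xz] := eqVneq x z.
  have -> : y = x by lra.
  by rewrite xz !subrr !mul0r addr0.
have zx : 0 < z - x by rewrite subr_gt0 lt_neqAle xz; lra.
have t0 : 0 <= (z - y) / (z - x) by rewrite divr_ge0 //; lra.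
have t1 : (z - y) / (z - x) <= 1 by rewrite ler_pdivrMr // mul1r; lra.
have := fconc (Itv01 t0 t1) x z; rewrite !inE => /(_ I I).
rewrite !convRE /= /unstable.onem => H.
have zx0 : z - x != 0 by rewrite gt_eqF.
have yE : (z - y) / (z - x) * x + (1 - (z - y) / (z - x)) * z = y by field.
have cE : conv (Itv01 t0 t1) (x : convex_lmodType R^o) (z : convex_lmodType R^o) = y.
  by rewrite -[RHS]yE.
rewrite cE -(ler_pM2l zx) in H.
have E : (z - x) * ((z - y) / (z - x) * - f x + (1 - (z - y) / (z - x)) * - f z)
   = - ((z - y) * f x + (y - x) * f z) by field.
rewrite E in H; lra.
Qed.

Section Lifting.

Context {R : realType} {n : nat}.
Variables (f : R -> R) (a : 'rV[R]_n) (mu : 'rV[int]_n) (s : 'I_n).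
Variables (S0 S1 : {set 'I_n}) (k : int).

Local Notation c := (a 0 s).
Local Notation K := (a 0 s * k%:~R).
Local Notation g := (gfun f a mu S1).
Local Notation slope := (rho f a mu s S1 k / c).

Definition tilted (z : R) : R :=
  g z - slope * z - (g K - slope * K).

(** Bounds as natural numbers, so that lattice points of the box become functions to [nat]. *)
Definition cap (i : 'I_n) : nat := absz (mu 0 i).

Local Notation Z := (step_envelope tilted c K).
Local Notation load := (total_load S0 (fun i => a 0 i)).
Local Notation cost := (lifting_cost tilted c K S0 (fun i => a 0 i)).
Local Notation value := (lifted_value tilted c K S0 (fun i => a 0 i)).

Hypothesis fconc : concave_function f.
Hypothesis a_ge0 : forall i, 0 <= a 0 i.
Hypothesis mu_ge1 : forall i, 1 <= mu 0 i.
Hypothesis as_gt0 : 0 < a 0 s.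
Hypothesis s_notin_S0 : s \notin S0.
Hypothesis s_notin_S1 : s \notin S1.
Hypothesis S0S1 : (S0 :&: S1)%SET = finset.set0.
Hypothesis cover : (s |: (S0 :|: S1))%SET = finset.setT.
Hypothesis k_bounds : 1 <= k <= mu 0 s.

Lemma S0_neq_s (i : 'I_n) : i \in S0 -> (i == s) = false.
Proof. by apply: contraTF => /eqP ->. Qed.

Lemma S1_neq_s (i : 'I_n) : i \in S1 -> (i == s) = false.
Proof. by apply: contraTF => /eqP ->. Qed.

Lemma capE (i : 'I_n) : (mu 0 i)%:~R = (cap i)%:R :> R.
Proof. by rewrite /cap natr_absz ger0_norm // (le_trans _ (mu_ge1 i)). Qed.

Lemma step_le_top : c <= K.
Proof. by apply: ler_peMr; [exact: ltW | rewrite ler1z; case/andP: k_bounds]. Qed.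

Lemma tilted_concave : concave_on_line tilted.
Proof.
move=> x y z xyz; pose B := \sum_(i in S1) (mu 0 i)%:~R * a 0 i.
have := concave_function_on_line fconc (x + B) (y + B) (z + B).
have BK u v : u + B - (v + B) = u - v by lra.
rewrite !BK !lerD2r => /(_ xyz); rewrite /tilted /gfun -/B.
set r := slope; lra.
Qed.

Lemma tilted_top : tilted K = 0.
Proof. by rewrite /tilted subrr. Qed.

Lemma tilted_bot : tilted (K - c) = 0.
Proof.
have c0 : c != 0 by rewrite gt_eqF.
have rhoE : rho f a mu s S1 k = g K - g (K - c).
  by rewrite /rho intrB mulrBl mul1r mulrC.
by rewrite /tilted mulrBr mulfVK // rhoE; lra.
Qed.

Let c0 := as_gt0.
Let cK := step_le_top.
Let Gconc := tilted_concave.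
Let GK := tilted_top.
Let GKc := tilted_bot.

Lemma gfunE (z : R) : g z = tilted z + slope * (z - K) + g K.
Proof. by rewrite /tilted mulrBr; lra. Qed.

(** Since [k <= mu 0 s], the bound on x_s in [zeta] does not cut off the optimum for [d >= 0]. *)
Lemma zeta_steps (d : R) : 0 <= d ->
  exists2 j : int, 0 <= j <= mu 0 s & Z d = tilted (d + c * j%:~R).
Proof.
move=> d0; have /andP[k1 kmu] := k_bounds.
apply: (envelope_steps_bounded tilted c K) => //; first by lia.
move: kmu (as_gt0); rewrite -(ler_int R) -(ler_pM2l as_gt0); lra.
Qed.

Lemma zetaE (d : R) : 0 <= d -> zeta f a mu s S1 k d = slope * d + Z d.
Proof.
move=> d0; have c_neq0 : c != 0 by rewrite gt_eqF.
have termE (x : int) : g (d + c * x%:~R) - rho f a mu s S1 k * (x - k)%:~R - g (k%:~R * c)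
    = slope * d + tilted (d + c * x%:~R).
  rewrite (mulrC k%:~R) gfunE.
  have -> : rho f a mu s S1 k * (x - k)%:~R = slope * (c * (x - k)%:~R).
    by rewrite mulrA mulfVK.
  by rewrite intrB; lra.
apply: maximum_eq => [|_ [x /= /andP[x0 _] <-]].
  by have [j hj ->] := zeta_steps d d0; exists j => //=; rewrite termE.
by rewrite termE lerD2l; apply: (envelope_max tilted c K).
Qed.

Lemma sum_zeta (x : 'I_n -> nat) :
  \sum_(i in S0) zeta f a mu s S1 k (a 0 i) * (x i)%:R = slope * load x + cost x.
Proof.
rewrite /total_load /lifting_cost mulr_sumr -big_split; apply: eq_bigr => i _ /=.
by rewrite zetaE // mulrDl mulrA.
Qed.

(** The linear parts of [g] along the items of [S0] and along x_s are cancelled by those of [zeta]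
    and by the [rho] term; only [slope * d] survives. *)
Lemma etaU_termE (d : R) (z : 'rV[int]_n) (x : 'I_n -> nat) :
  (forall i, i \in S0 -> z 0 i = (x i)%:Z) ->
  g (d + \sum_(i in (s |: S0)%SET) a 0 i * (z 0 i)%:~R)
    - \sum_(i in S0) zeta f a mu s S1 k (a 0 i) * (z 0 i)%:~R
    + (k - z 0 s)%:~R * rho f a mu s S1 k - g (k%:~R * c)
  = slope * d + (tilted (d + load x + c * (z 0 s)%:~R) - cost x).
Proof.
move=> zx; rewrite big_setU1 //=.
have -> : \sum_(i in S0) a 0 i * (z 0 i)%:~R = load x.
  by apply: eq_bigr => i iS; rewrite zx.
have -> : \sum_(i in S0) zeta f a mu s S1 k (a 0 i) * (z 0 i)%:~R
    = slope * load x + cost x.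
  by rewrite -sum_zeta; apply: eq_bigr => i iS; rewrite zx.
have -> : (k - z 0 s)%:~R * rho f a mu s S1 k = slope * (c * (k - z 0 s)%:~R).
  by rewrite mulrA mulfVK ?gt_eqF // mulrC.
rewrite (mulrC k%:~R) addrCA (addrC (c * _)) gfunE intrB; lra.
Qed.

Lemma eq_value (d : R) (x y : 'I_n -> nat) :
  (forall i, i \in S0 -> x i = y i) -> value d x = value d y.
Proof.
move=> xy; rewrite /lifted_value /lifting_cost /total_load.
by congr (Z (_ + _) - _); apply: eq_bigr => i /xy ->.
Qed.

(** A maximum over a finite type: on [S0] the box embeds into functions bounded by the sum of all
    caps, and [value] reads no other coordinates. *)
Lemma value_max (d : R) : exists2 x : 'I_n -> nat,
  (forall i, i \in S0 -> (x i <= cap i)%N) &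
  (forall y : 'I_n -> nat, (forall i, i \in S0 -> (y i <= cap i)%N) ->
    value d y <= value d x).
Proof.
pose N := (\sum_i cap i)%N.
pose P (x : {ffun 'I_n -> 'I_N.+1}) := [forall (i | i \in S0), (x i <= cap i)%N].
pose F (x : {ffun 'I_n -> 'I_N.+1}) := value d (fun i => x i).
have P0 : P [ffun => ord0] by apply/forall_inP => i _; rewrite ffunE.
case: (arg_maxP F P0) => x /forall_inP Px xmax.
exists (fun i => x i : nat) => // y ycap.
have capN i : (cap i <= N)%N by rewrite /N (bigD1 i) //= leq_addr.
have yE i : i \in S0 -> [ffun i => inord (y i) : 'I_N.+1] i = y i :> nat.
  by move=> iS; rewrite ffunE inordK // ltnS (leq_trans (ycap _ iS)).
rewrite (@eq_value _ y (fun i => [ffun i => inord (y i) : 'I_N.+1] i : nat)).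
  by apply: xmax; apply/forall_inP => i iS; rewrite yE // ycap.
by move=> i iS; rewrite yE.
Qed.

(** Maximising over x_s replaces [tilted] by its envelope and leaves a finite maximum over [S0].
    Attainment and upper bound together stand in for [maximum] from here on. *)
Lemma etaU_spec (d : R) :
  (exists2 x : 'I_n -> nat, (forall i, i \in S0 -> (x i <= cap i)%N) &
     etaU f a mu s S0 S1 k d = slope * d + value d x) /\
  (forall y : 'I_n -> nat, (forall i, i \in S0 -> (y i <= cap i)%N) ->
     slope * d + value d y <= etaU f a mu s S0 S1 k d).
Proof.
have [x xcap xmax] := value_max d.
suff E : etaU f a mu s S0 S1 k d = slope * d + value d x.
  by split=> [|y ycap]; [exists x | rewrite E lerD2l xmax].
have capz i : (cap i)%:Z = mu 0 i by rewrite /cap gez0_abs // (le_trans _ (mu_ge1 i)).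
apply: maximum_eq => [|_ [z /= [zS0 zs0] <-]].
  have [j j0 ZE] : exists2 j : int, 0 <= j &
      Z (d + load x) = tilted (d + load x + c * j%:~R).
    have [dK|Kd] := lerP (d + load x) K.
      have [j [j0 _ ->]] := envelope_steps_le tilted c K c0 _ dK; by exists j.
    by exists 0 => //; rewrite (envelope_ge tilted c K c0 _ (ltW Kd)) mulr0 addr0.
  pose z := \row_i (if i == s then j else (x i)%:Z).
  have zs : z 0 s = j by rewrite mxE eqxx.
  have zx i : i \in S0 -> z 0 i = (x i)%:Z.
    by move=> iS; rewrite mxE S0_neq_s.
  exists z => /=; last by rewrite (etaU_termE _ _ x) // zs -ZE.
  by rewrite zs; split=> // i iS; rewrite zx // -capz !lez_nat xcap.
have zx i : i \in S0 -> z 0 i = (absz (z 0 i))%:Z by move=> /zS0/andP[zi _]; rewrite gez0_abs.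
rewrite (etaU_termE _ _ (fun i => absz (z 0 i))) // lerD2l.
apply: le_trans (xmax (fun i => absz (z 0 i)) _).
  by rewrite lerD2r (envelope_max tilted c K).
by move=> i iS; rewrite -lez_nat -zx // capz; case/andP: (zS0 i iS).
Qed.

Lemma etaU0_le0 : etaU f a mu s S0 S1 k 0 <= 0.
Proof.
have [[x _ ->] _] := etaU_spec 0.
by rewrite mulr0 add0r (lifted_value0_le0 tilted c K _ _ _ _ _ k).
Qed.

Lemma etaU_subadditive (d e : R) : d <= 0 -> e <= 0 ->
  etaU f a mu s S0 S1 k (d + e)
    <= etaU f a mu s S0 S1 k d + etaU f a mu s S0 S1 k e.
Proof.
move=> d0 e0; have [[x xcap ->] _] := etaU_spec (d + e).
have [_ dub] := etaU_spec d; have [_ eub] := etaU_spec e.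
(* The greedy splitting starts from the empty load, which fits because [d <= 0]. *)
have [||y [z [yx zx]]] := lifted_value_split tilted c K c0 cK Gconc GK GKc k erefl
  S0 (fun i => a 0 i) d e x (fun=> 0%N) d0 e0.
- by [].
- by rewrite /total_load big1 ?addr0 // => i _; rewrite mulr0.
have {}dub := dub y (fun i iS => leq_trans (yx i iS) (xcap i iS)).
have {}eub := eub z (fun i iS => leq_trans (zx i iS) (xcap i iS)).
by rewrite mulrDr; lra.
Qed.

Lemma etaU_sum (y : 'I_n -> nat) :
  etaU f a mu s S0 S1 k (- \sum_(i in S1) a 0 i * (y i)%:R)
    <= \sum_(i in S1) etaU f a mu s S0 S1 k (- a 0 i) * (y i)%:R.
Proof.
set E := etaU _ _ _ _ _ _ _.
have mulE i (m : nat) : 0 <= a 0 i * m%:R /\ E (- (a 0 i * m%:R)) <= E (- a 0 i) * m%:R.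
  elim: m => [|m [IH0 IHm]]; first by rewrite !mulr0 oppr0 etaU0_le0.
  rewrite -natr1 !mulrDr !mulr1 opprD; split; first by rewrite addr_ge0.
  by apply: le_trans (etaU_subadditive _ _ _ _) _; rewrite ?oppr_le0 ?lerD2r.
suff [] : 0 <= \sum_(i in S1) a 0 i * (y i)%:R /\
    E (- \sum_(i in S1) a 0 i * (y i)%:R) <= \sum_(i in S1) E (- a 0 i) * (y i)%:R by [].
apply: (big_ind2 (fun p q => 0 <= p /\ E (- p) <= q)).
- by rewrite oppr0 etaU0_le0.
- move=> p q p' q' [p0 pq] [p'0 p'q']; split; first by rewrite addr_ge0.
  by rewrite opprD; apply: le_trans (etaU_subadditive _ _ _ _) _;
    rewrite ?oppr_le0 ?lerD.
- by move=> i _; exact: mulE.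
Qed.

(** * Slack and validity at lattice points *)

Lemma sum_cover (F : 'I_n -> R) :
  \sum_i F i = F s + \sum_(i in S0) F i + \sum_(i in S1) F i.
Proof.
have -> : \sum_i F i = \sum_(i in (s |: (S0 :|: S1))%SET) F i.
  by rewrite cover; apply: eq_bigl => i; rewrite finset.in_setT.
rewrite big_setU1 ?finset.in_setU ?negb_or ?s_notin_S0 //=.
have dis : fintype.disjoint (mem S0) (mem S1) by rewrite -finset.setI_eq0 S0S1.
rewrite -addrA -bigU //=; congr (_ + _).
by apply: eq_bigl => i; rewrite !inE.
Qed.

(** What the [S1] items lack from their full load, which the shift in [gfun] makes the origin. *)
Definition S1_drop (z : 'I_n -> nat) : R := \sum_(i in S1) a 0 i * (cap i - z i)%:R.

(** The slack is the sum of the [etaU] terms minus the objective of [etaU] at [- S1_drop z], so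
    validity and tightness can both be read off. *)
Lemma lifted_rhs_gap (z : 'I_n -> nat) : (forall i, (z i <= cap i)%N) ->
  lifted_rhs f a mu s S0 S1 k (\row_i (z i)%:R) - f (\sum_i a 0 i * (z i)%:R)
  = \sum_(i in S1) etaU f a mu s S0 S1 k (- a 0 i) * (cap i - z i)%:R
    - (slope * - S1_drop z
       + (tilted (- S1_drop z + load z + c * (z s)%:R) - cost z)).
Proof.
move=> zcap; rewrite /lifted_rhs.
under eq_bigr do rewrite mxE.
under [X in _ + X + _ + _ - _]eq_bigr do rewrite mxE capE -natrB //.
rewrite sum_zeta mxE.
have -> : f (\sum_i a 0 i * (z i)%:R) = g (- S1_drop z + load z + c * (z s)%:R).
  rewrite /gfun sum_cover; congr (f _).
  have -> : \sum_(i in S1) (mu 0 i)%:~R * a 0 i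
      = S1_drop z + \sum_(i in S1) a 0 i * (z i)%:R.
    rewrite -big_split; apply: eq_bigr => i _ /=.
    by rewrite capE natrB //; lra.
  by rewrite /total_load; lra.
have -> : rho f a mu s S1 k * ((z s)%:R - k%:~R) = slope * (c * ((z s)%:R - k%:~R)).
  by rewrite mulrA mulfVK ?gt_eqF.
by rewrite (mulrC k%:~R) (gfunE (_ + _)); lra.
Qed.

Lemma lifted_valid (z : 'I_n -> nat) : (forall i, (z i <= cap i)%N) ->
  f (\sum_i a 0 i * (z i)%:R) <= lifted_rhs f a mu s S0 S1 k (\row_i (z i)%:R).
Proof.
move=> zcap; rewrite -subr_ge0 lifted_rhs_gap // subr_ge0.
apply: le_trans (etaU_sum (fun i => cap i - z i)%N).
have [_ ub] := etaU_spec (- S1_drop z).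
apply: le_trans (ub z (fun i _ => zcap i)).
by rewrite lerD2l lerD2r (envelope_max tilted c K c0 cK Gconc GK GKc _ (z s)%:Z).
Qed.

Definition vertex (z : 'I_n -> nat) : wx_space R n :=
  (f (\sum_i a 0 i * (z i)%:R), \row_i (z i)%:R).

Lemma vertex_in_calX (z : 'I_n -> nat) : (forall i, (z i <= cap i)%N) ->
  calX f a mu (vertex z).
Proof.
move=> zcap; split=> [|i|i] /=.
- suff -> : \sum_i a 0 i * (\row_j (z j)%:R) 0 i = \sum_i a 0 i * (z i)%:R by [].
  by apply: eq_bigr => i _; rewrite mxE.
- by rewrite mxE.
- by rewrite mxE ler0n capE ler_nat zcap.
Qed.

Lemma calX_vertex (p : wx_space R n) : calX f a mu p ->
  exists z, [/\ forall i, (z i <= cap i)%N, p.2 = \row_i (z i)%:R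
              & p.1 <= f (\sum_i a 0 i * (z i)%:R)].
Proof.
case=> pf pint pbox; pose z i := absz (Num.floor (p.2 0 i)).
have zE i : p.2 0 i = (z i)%:R.
  have /andP[p0 _] := pbox i.
  by rewrite /z natr_absz ger0_norm ?floor_ge0 // floorK.
exists z; split=> [i||].
- by have /andP[_] := pbox i; rewrite zE capE ler_nat.
- by apply/rowP => i; rewrite mxE.
- by under eq_bigr do rewrite -zE.
Qed.

(** * Tight lattice points and their independence *)

Lemma sum_pred1 (S : {set 'I_n}) (F : 'I_n -> R) (i : 'I_n) : i \in S ->
  \sum_(l in S) F l * (l == i)%:R = F i.
Proof.
move=> iS; rewrite (bigD1 i) //= eqxx mulr1 big1 ?addr0 // => l /andP[_ /negbTE ->].
by rewrite mulr0.
Qed.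

(** On [S1] coordinates are measured downwards from the bound, matching the terms mu_i - x_i of the
    inequality. *)
Definition mix (j : int) (x y : 'I_n -> nat) (i : 'I_n) : nat :=
  if i == s then absz j else if i \in S0 then x i else (cap i - y i)%N.

Lemma mix_s (j : int) (x y : 'I_n -> nat) : mix j x y s = absz j.
Proof. by rewrite /mix eqxx. Qed.

Lemma mix_S0 (j : int) (x y : 'I_n -> nat) (i : 'I_n) : i \in S0 -> mix j x y i = x i.
Proof. by move=> iS; rewrite /mix S0_neq_s // iS. Qed.

Lemma mix_S1 (j : int) (x y : 'I_n -> nat) (i : 'I_n) :
  i \in S1 -> mix j x y i = (cap i - y i)%N.
Proof.
move=> iS; rewrite /mix S1_neq_s //.
have : i \notin (S0 :&: S1)%SET by rewrite S0S1 finset.in_set0.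
by rewrite finset.in_setI iS andbT => /negbTE ->.
Qed.

Lemma mix_tight (j : int) (x y : 'I_n -> nat) : 0 <= j <= mu 0 s ->
  (forall i, i \in S0 -> (x i <= cap i)%N) ->
  (forall i, i \in S1 -> (y i <= cap i)%N) ->
  \sum_(i in S1) etaU f a mu s S0 S1 k (- a 0 i) * (y i)%:R
    = slope * - \sum_(i in S1) a 0 i * (y i)%:R
      + (tilted (- \sum_(i in S1) a 0 i * (y i)%:R + load x + c * j%:~R) - cost x) ->
  (forall i, (mix j x y i <= cap i)%N) /\
  f (\sum_i a 0 i * (mix j x y i)%:R)
    = lifted_rhs f a mu s S0 S1 k (\row_i (mix j x y i)%:R).
Proof.
move=> /andP[j0 jmu] xcap ycap tight.
have mixcap i : (mix j x y i <= cap i)%N.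
  rewrite /mix; case: eqP => [->|_]; first by rewrite /cap; lia.
  by case: ifP => [/xcap//|_]; rewrite leq_subr.
split=> //; apply/esym/eqP; rewrite -subr_eq0 lifted_rhs_gap // subr_eq0; apply/eqP.
have dropE : S1_drop (mix j x y) = \sum_(i in S1) a 0 i * (y i)%:R.
  by apply: eq_bigr => i iS; rewrite mix_S1 // subKn // ycap.
have -> : load (mix j x y) = load x by apply: eq_bigr => i iS; rewrite mix_S0.
have -> : cost (mix j x y) = cost x by apply: eq_bigr => i iS; rewrite mix_S0.
have -> : \sum_(i in S1) etaU f a mu s S0 S1 k (- a 0 i) * (cap i - mix j x y i)%:R
    = \sum_(i in S1) etaU f a mu s S0 S1 k (- a 0 i) * (y i)%:R.
  by apply: eq_bigr => i iS; rewrite mix_S1 // subKn // ycap.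
by rewrite dropE mix_s natr_absz ger0_norm // tight.
Qed.

Lemma mix_tight_S0 (j : int) (x : 'I_n -> nat) : 0 <= j <= mu 0 s ->
  (forall i, i \in S0 -> (x i <= cap i)%N) ->
  tilted (load x + c * j%:~R) = cost x ->
  (forall i, (mix j x (fun=> 0%N) i <= cap i)%N) /\
  f (\sum_i a 0 i * (mix j x (fun=> 0%N) i)%:R)
    = lifted_rhs f a mu s S0 S1 k (\row_i (mix j x (fun=> 0%N) i)%:R).
Proof.
move=> hj xcap xtight; apply: mix_tight => //.
rewrite !big1 => [|i _|i _]; rewrite ?mulr0 //.
by rewrite oppr0 mulr0 !add0r xtight subrr.
Qed.

Lemma load0 : load (fun=> 0%N) = 0.
Proof. by apply: big1 => i _; rewrite mulr0. Qed.

Lemma cost0 : cost (fun=> 0%N) = 0.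
Proof. by apply: big1 => i _; rewrite mulr0. Qed.

(** The two zeros [K] and [K - c] of [tilted] give two tight points that differ only in coordinate
    [s]. *)
Lemma mix_tight_s (j : int) : j = k \/ j = k - 1 ->
  (forall i, (mix j (fun=> 0%N) (fun=> 0%N) i <= cap i)%N) /\
  f (\sum_i a 0 i * (mix j (fun=> 0%N) (fun=> 0%N) i)%:R)
    = lifted_rhs f a mu s S0 S1 k (\row_i (mix j (fun=> 0%N) (fun=> 0%N) i)%:R).
Proof.
move=> jE; have := k_bounds; move=> /andP[k1 kmu].
apply: mix_tight_S0 => //; first by case: jE => ->; lia.
rewrite load0 cost0 add0r; case: jE => ->; first exact: tilted_top.
by rewrite intrB mulrBr mulr1 tilted_bot.
Qed.

(** One tight point per coordinate, to be compared with the base point where x_s is [k], [S0] is at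
    0 and [S1] at its bounds. The last three clauses record the triangular shape; for [i] in [S1]
    the other coordinates are left free. *)
Lemma tight_vertices :
  (forall i, i \in S1 ->
      (k - mu 0 s - 1)%:~R * c - \sum_(j in S0plus a s S0 k) (mu 0 j)%:~R * a 0 j
      <= - a 0 i) ->
  forall i, exists z : 'I_n -> nat,
    [/\ (forall l, (z l <= cap l)%N),
        f (\sum_l a 0 l * (z l)%:R) = lifted_rhs f a mu s S0 S1 k (\row_l (z l)%:R),
        forall l, l \in S1 -> z l = (cap l - (l == i))%N,
        i \notin S1 -> forall l, l \in S0 -> z l = (l == i)
      & i = s -> z s = absz (k - 1)].
Proof.
move=> small i; have /andP[k1 kmu] := k_bounds.
have cap1 l : (1 <= cap l)%N by have := mu_ge1 l; rewrite /cap; lia.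
have [->|i_neq_s] := eqVneq i s.
  have [zcap ztight] := mix_tight_s (k - 1) (or_intror erefl).
  exists (mix (k - 1) (fun=> 0%N) (fun=> 0%N)); split=> // [l lS|_ l lS|_].
  - by rewrite mix_S1 // S1_neq_s.
  - by rewrite mix_S0 // S0_neq_s.
  - exact: mix_s.
have [iS1|iS1] := boolP (i \in S1).
  have [[x xcap etaE] ub] := etaU_spec (- a 0 i).
  (* Once [- a 0 i + load y] is at least [L], [mu 0 s] steps suffice, so x_s stays in the box. The
     size condition lets the large items reach [L], and the grown [y] is still optimal. *)
  pose L := K - c - c * (mu 0 s)%:~R.
  have LE : L = (k - mu 0 s - 1)%:~R * c by rewrite /L !intrB; lra.
  have L0 : L <= 0.
    by rewrite LE pmulr_lle0 // lerz0; lia.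
  have plusE : \sum_(j in S0plus a s S0 k) (mu 0 j)%:~R * a 0 j
      = \sum_(l in S0 | K <= a 0 l) a 0 l * (cap l)%:R.
    by apply: eq_big => l; rewrite ?inE mulrC // => _; rewrite capE mulrC.
  have := lifted_value_grow tilted c K c0 cK Gconc GK GKc k erefl S0 (fun l => a 0 l)
    a_ge0 (- a 0 i) L x cap L0 xcap.
  have := small i iS1; rewrite -LE plusE => small_i grow.
  have [|y [ycap Ly xy]] := grow; first by move: small_i; lra.
  have [j hj ZE] := envelope_steps_bounded tilted c K c0 cK GK GKc
    (- a 0 i + load y) (mu 0 s) (le_trans ler01 (mu_ge1 s)) Ly.
  have {}ub := ub y ycap.
  have yE : value (- a 0 i) y = value (- a 0 i) x.
    by apply/eqP; rewrite eq_le xy andbT; move: ub; rewrite etaE lerD2l.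
  have [||zcap ztight] := mix_tight j y (fun l => l == i) hj ycap.
  - by move=> l _; case: eqP => // _; exact: cap1.
  - by rewrite !sum_pred1 // etaE -yE /lifted_value ZE.
  exists (mix j y (fun l => l == i)); split=> // [l lS|is_].
  - exact: mix_S1.
  - by rewrite is_ eqxx in i_neq_s.
have iS0 : i \in S0.
  have : i \in (s |: (S0 :|: S1))%SET by rewrite cover finset.in_setT.
  by rewrite finset.in_setU1 finset.in_setU (negbTE i_neq_s) (negbTE iS1) orbF.
have [j hj ZE] := zeta_steps (a 0 i) (a_ge0 i).
have [||zcap ztight] := mix_tight_S0 j (fun l => l == i) hj.
- by move=> l _; case: eqP => // _; exact: cap1.
- by rewrite /total_load /lifting_cost !sum_pred1.
exists (mix j (fun l => l == i) (fun=> 0%N)); split=> // [l lS|_ l lS|is_].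
- rewrite mix_S1 //; case: eqP => // li; by rewrite -li lS in iS1.
- exact: mix_S0.
- by rewrite is_ eqxx in i_neq_s.
Qed.

(** Elimination by coordinates: those in [S1] isolate their own coefficient, then those in [S0] do,
    and finally [s], where the difference is -1. *)
Lemma tight_vertices_free (z : 'I_n -> 'I_n -> nat) (c : 'I_n -> R) :
  (forall i l, l \in S1 -> z i l = (cap l - (l == i))%N) ->
  (forall i, i \notin S1 -> forall l, l \in S0 -> z i l = (l == i)) ->
  z s s = absz (k - 1) ->
  \sum_i c i *: ((vertex (z i)).2 - (vertex (mix k (fun=> 0%N) (fun=> 0%N))).2) = 0 ->
  forall i, c i = 0.
Proof.
set z0 := mix _ _ _ => zS1 zS0 zs cz0.
have cz0i i : \sum_j c j * ((z j i)%:R - (z0 i)%:R) = 0.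
  have /rowP/(_ i) := cz0; rewrite summxE mxE => E.
  by rewrite -[RHS]E; apply: eq_bigr => j _; rewrite !mxE.
have cap1 i : (1 <= cap i)%N by have := mu_ge1 i; rewrite /cap; lia.
have cS1 i : i \in S1 -> c i = 0.
  move=> iS; have := cz0i i; rewrite (bigD1 i) //= big1 => [|j ji].
    rewrite zS1 // eqxx.
    rewrite /z0 mix_S1 // subn0 natrB //= => E.
    by move: E; lra.
  rewrite zS1 // eq_sym (negbTE ji).
  by rewrite /z0 mix_S1 // subrr mulr0.
have cS0 i : i \in S0 -> c i = 0.
  move=> iS; have := cz0i i; rewrite (bigD1 i) //= big1 => [|j ji].
    have [iS1|iS1] := boolP (i \in S1); first by rewrite cS1.
    rewrite zS0 // eqxx.
    by rewrite /z0 mix_S0 // subr0 mulr1 addr0.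
  have [jS1|jS1] := boolP (j \in S1); first by rewrite cS1 // mul0r.
  rewrite zS0 // eq_sym (negbTE ji).
  by rewrite /z0 mix_S0 // subrr mulr0.
have cs : c s = 0.
  have := cz0i s; rewrite (bigD1 s) //= big1 => [|j js].
    rewrite zs /z0 mix_s.
    have /andP[k1 _] := k_bounds.
    rewrite !natr_absz !ger0_norm; [|lia|lia].
    by rewrite intrB; lra.
  have : j \in (s |: (S0 :|: S1))%SET by rewrite cover finset.in_setT.
  rewrite finset.in_setU1 finset.in_setU (negbTE js) /=.
  by move=> /orP[/cS0|/cS1] ->; rewrite mul0r.
move=> i; have : i \in (s |: (S0 :|: S1))%SET by rewrite cover finset.in_setT.
by rewrite finset.in_setU1 finset.in_setU => /or3P[/eqP->|/cS0|/cS1].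
Qed.

End Lifting.

(** * Affine dimension and the graph of an affine function *)

Lemma lifted_rhs_affine {R : realType} {n : nat} (f : R -> R) (a : 'rV[R]_n)
    (mu : 'rV[int]_n) (s : 'I_n) (S0 S1 : {set 'I_n}) (k : int) :
  exists (b : R) (l : 'rV[R]_n), forall x : 'rV[R]_n,
    lifted_rhs f a mu s S0 S1 k x = b + \sum_i l 0 i * x 0 i.
Proof.
set ze := zeta f a mu s S1 k; set et := etaU f a mu s S0 S1 k.
set r := rho f a mu s S1 k.
exists (\sum_(i in S1) et (- a 0 i) * (mu 0 i)%:~R - r * k%:~R
        + gfun f a mu S1 (k%:~R * a 0 s)).
exists (\row_i ((if i \in S0 then ze (a 0 i) else 0)
          - (if i \in S1 then et (- a 0 i) else 0) + r * (i == s)%:R)) => x.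
have -> : \sum_i (\row_i ((if i \in S0 then ze (a 0 i) else 0)
          - (if i \in S1 then et (- a 0 i) else 0) + r * (i == s)%:R)) 0 i * x 0 i
  = \sum_(i in S0) ze (a 0 i) * x 0 i - \sum_(i in S1) et (- a 0 i) * x 0 i
    + r * x 0 s.
  transitivity (\sum_i ((if i \in S0 then ze (a 0 i) * x 0 i else 0)
    - (if i \in S1 then et (- a 0 i) * x 0 i else 0)
    + (if i == s then r * x 0 i else 0))).
    apply: eq_bigr => i _; rewrite mxE mulrDl mulrBl.
    by case: (i \in S0); case: (i \in S1); case: (i == s); rewrite ?mul0r ?mulr0 ?mulr1 ?mul0r.
  by rewrite big_split sumrB /= -!big_mkcond /= big_pred1_eq.
rewrite /lifted_rhs.
have -> : \sum_(i in S1) et (- a 0 i) * ((mu 0 i)%:~R - x 0 i)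
  = \sum_(i in S1) et (- a 0 i) * (mu 0 i)%:~R - \sum_(i in S1) et (- a 0 i) * x 0 i.
  by rewrite -sumrB; apply: eq_bigr => i _; rewrite mulrBr.
by rewrite -/ze -/r; lra.
Qed.

Section GraphOfAffine.

Context {R : realType} {n : nat}.
Variables (h : 'rV[R]_n -> R) (b : R) (l : 'rV[R]_n).
Hypothesis hE : forall x, h x = b + \sum_i l 0 i * x 0 i.

Lemma wx_sum1 (I : finType) (q : I -> wx_space R n) : (\sum_i q i).1 = \sum_i (q i).1.
Proof. by elim/big_ind2: _ => // x1 x2 y1 y2 <- <-. Qed.

Lemma wx_sum2 (I : finType) (q : I -> wx_space R n) : (\sum_i q i).2 = \sum_i (q i).2.
Proof. by elim/big_ind2: _ => // x1 x2 y1 y2 <- <-. Qed.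

Lemma affine_combination0 (r : nat) (c : 'I_r -> R) (x : 'I_r -> 'rV[R]_n) :
  \sum_i c i = 0 -> \sum_i c i *: x i = 0 -> \sum_i c i * h (x i) = 0.
Proof.
move=> c0 cx0; under eq_bigr do rewrite hE mulrDr.
rewrite big_split /= -mulr_suml c0 mul0r add0r.
under eq_bigr do rewrite mulr_sumr.
rewrite exchange_big /=; apply: big1 => j _.
under eq_bigr do rewrite mulrCA.
rewrite -mulr_sumr; have /rowP/(_ j) := cx0; rewrite summxE mxE => E.
suff -> : \sum_i c i * x i 0 j = 0 by rewrite mulr0.
by rewrite -[RHS]E; apply: eq_bigr => i _; rewrite mxE.
Qed.

(** The inequality cuts out a half-space, a convex set containing [A], hence containing its hull. *)
Lemma conv_hull_valid (A : set (wx_space R n)) :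
  valid_ineq (fun p : wx_space R n => p.1) (fun p => h p.2) A ->
  valid_ineq (fun p : wx_space R n => p.1) (fun p => h p.2) (conv_hull A).
Proof.
move=> Avalid; apply: smallest_sub => //.
move=> x y t; rewrite !inE /= => xA yA.
have E : h (t%:num *: x.2 + unstable.onem t%:num *: y.2)
    = t%:num * h x.2 + (1 - t%:num) * h y.2.
  rewrite /unstable.onem !hE !mulrDr !mulr_sumr.
  transitivity (b + \sum_i (t%:num * (l 0 i * x.2 0 i)
    + (1 - t%:num) * (l 0 i * y.2 0 i))).
    by congr (_ + _); apply: eq_bigr => i _; rewrite !mxE /=; ring.
  by rewrite big_split /=; lra.
rewrite E /unstable.onem.
have t0 : 0 <= t%:num by [].
have t1 : 0 <= 1 - t%:num by rewrite subr_ge0.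
by apply: lerD; rewrite ler_wpM2l.
Qed.

Lemma dim_wx : \dim {: wx_space R n} = n.+1.
Proof. by rewrite dimvf; change ((1 + 1 * n)%N = n.+1); rewrite mul1n. Qed.

Lemma affdim_eq (A : set (wx_space R n)) (r : nat) (t : r.-tuple (wx_space R n)) :
  (r <= n.+2)%N -> affinely_independent t -> (forall i, A (tnth t i)) ->
  (forall r' (t' : r'.-tuple (wx_space R n)), (r' <= n.+2)%N ->
     affinely_independent t' -> (forall i, A (tnth t' i)) -> (r' <= r)%N) ->
  affdim A = r%:Z - 1.
Proof.
move=> rn tind tA tmax; rewrite /affdim; congr (Posz _ - 1); apply/eqP.
rewrite eqn_leq; apply/andP; split.
  apply/bigmax_leqP => i /asboolP[t' [t'ind t'A]]; apply: (tmax _ t') => //.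
  by rewrite -ltnS; apply: leq_trans (ltn_ord i) _; rewrite dim_wx.
have rdim : (r < (\dim {: wx_space R n}).+2)%N by rewrite dim_wx.
apply: (@leq_bigmax_cond _ _ (fun i : 'I__ => i : nat) (Ordinal rdim)).
by apply/asboolP; exists t.
Qed.

(** On the graph the first coordinate follows from the others, so prefixing 1 to the x-part gives
    linearly independent rows of length [n + 1]. *)
Lemma affinely_independent_graph_le (r : nat) (t : r.-tuple (wx_space R n)) :
  affinely_independent t -> (forall i, (tnth t i).1 = h (tnth t i).2) -> (r <= n.+1)%N.
Proof.
move=> tind tgraph.
pose M := \matrix_(i < r) row_mx (1%:M : 'M[R]_1) (tnth t i).2.
suff : row_free M by rewrite /row_free => /eqP <-; rewrite (leq_trans (rank_leq_col _)).
apply: inj_row_free => v vM; apply/rowP => i; rewrite mxE.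
have vME : \sum_i v 0 i *: row_mx (1%:M : 'M[R]_1) (tnth t i).2 = 0.
  transitivity (v *m M) => //; rewrite mulmx_sum_row.
  by apply: eq_bigr => j _; rewrite rowK.
have v0 : \sum_i v 0 i = 0.
  have /rowP/(_ (lshift n ord0)) := vME; rewrite summxE mxE => E.
  rewrite -[RHS]E; apply: eq_bigr => j _.
  by rewrite mxE row_mxEl mxE eqxx mulr1.
have vx0 : \sum_i v 0 i *: (tnth t i).2 = 0.
  apply/rowP => j; have /rowP/(_ (rshift 1 j)) := vME; rewrite !summxE !mxE => E.
  by rewrite -[RHS]E; apply: eq_bigr => m _; rewrite mxE [RHS]mxE row_mxEr.
apply: (tind (fun i => v 0 i)) => //.
rewrite [LHS]surjective_pairing wx_sum1 wx_sum2 /= vx0.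
under eq_bigr do rewrite tgraph.
by congr pair; exact: affine_combination0.
Qed.

(** Comparing a dependency in the first coordinate with its image under [h] leaves only the
    coefficient of [p] times [p.1 - h p.2]. *)
Lemma affinely_independent_cons (r : nat) (p : wx_space R n) (q : 'I_r -> wx_space R n) :
  p.1 != h p.2 -> (forall i, (q i).1 = h (q i).2) ->
  affinely_independent [tuple q i | i < r] ->
  affinely_independent [tuple oapp q p (unlift ord0 i) | i < r.+1].
Proof.
move=> ph qh qind c c0 cp0.
have tE i : tnth [tuple oapp q p (unlift ord0 i) | i < r.+1] i = oapp q p (unlift ord0 i).
  by rewrite tnth_mktuple.
have ch0 : \sum_i c i * (oapp q p (unlift ord0 i)).1 = 0.
  have /(congr1 fst) := cp0; rewrite wx_sum1 /= => E.
  by rewrite -[RHS]E; apply: eq_bigr => i _; rewrite tE.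
have cx0 : \sum_i c i *: (oapp q p (unlift ord0 i)).2 = 0.
  have /(congr1 snd) := cp0; rewrite wx_sum2 /= => E.
  by rewrite -[RHS]E; apply: eq_bigr => i _; rewrite tE.
have c00 : c ord0 = 0.
  have := affine_combination0 _ _ _ c0 cx0.
  rewrite big_ord_recl /= unlift_none /=.
  move: ch0; rewrite big_ord_recl /= unlift_none /= => ch0 ch0'.
  have : c ord0 * (p.1 - h p.2) = 0.
    rewrite mulrBr; have : \sum_(i < r) c (lift ord0 i) * (oapp q p (unlift ord0 (lift ord0 i))).1
      = \sum_(i < r) c (lift ord0 i) * h (oapp q p (unlift ord0 (lift ord0 i))).2.
      by apply: eq_bigr => i _; rewrite liftK /= qh.
    by move: ch0 ch0'; lra.
  by move/eqP; rewrite mulf_eq0 subr_eq0 (negbTE ph) orbF => /eqP.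
move=> i; case: (unliftP ord0 i) => [j ->|-> //].
apply: (qind (fun j => c (lift ord0 j))).
  by move: c0; rewrite big_ord_recl c00 add0r.
move: cp0; rewrite big_ord_recl c00 scale0r add0r => cp0; rewrite -[RHS]cp0.
by apply: eq_bigr => m _; rewrite !tnth_mktuple liftK.
Qed.

(** The coefficient of [p] is minus the sum of the others, which turns a dependency into a linear
    relation between differences. *)
Lemma affinely_independent_base (p : wx_space R n) (q : 'I_n -> wx_space R n) :
  (forall c : 'I_n -> R, \sum_i c i *: ((q i).2 - p.2) = 0 -> forall i, c i = 0) ->
  affinely_independent [tuple oapp q p (unlift ord0 i) | i < n.+1].
Proof.
move=> qfree c c0 cp0.
have cx0 : \sum_i c i *: (oapp q p (unlift ord0 i)).2 = 0.
  have /(congr1 snd) := cp0; rewrite wx_sum2 /= => E.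
  by rewrite -[RHS]E; apply: eq_bigr => i _; rewrite tnth_mktuple.
have cl j : c (lift ord0 j) = 0.
  apply: (qfree (fun j => c (lift ord0 j))).
  under eq_bigr do rewrite scalerBr.
  rewrite sumrB -scaler_suml.
  move: c0 cx0; rewrite !big_ord_recl unlift_none /=.
  under [X in _ -> _ + X = _ -> _]eq_bigr do rewrite liftK /=.
  move=> /eqP; rewrite addrC addr_eq0 => /eqP -> cx0.
  by rewrite scaleNr opprK addrC.
move=> i; case: (unliftP ord0 i) => [j -> //|->].
by move: c0; rewrite big_ord_recl big1 ?addr0 // => j _; rewrite cl.
Qed.

End GraphOfAffine.

(** * Validity on all of [calX], and the dimension count for the facet *)

Theorem theorem4p14 (R : realType) (n : nat) (hn : (1 <= n)%N)
    (f : R -> R) (hf : concave_function f)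
    (a : 'rV[R]_n) (ha : forall i, 0 <= a 0 i)
    (mu : 'rV[int]_n) (hmu : forall i, 1 <= mu 0 i)
    (s : 'I_n) (has_pos : 0 < a 0 s)
    (S0 S1 : {set 'I_n})
    (hs0 : s \notin S0) (hs1 : s \notin S1) (hdisj : (S0 :&: S1)%SET = finset.set0)
    (hcover : (s |: (S0 :|: S1))%SET = finset.setT)
    (k : int) (hk : 1 <= k <= mu 0 s) :
  valid_ineq (fun p : wx_space R n => p.1)
    (fun p => lifted_rhs f a mu s S0 S1 k p.2) (calX f a mu) /\
  ((forall i, i \in S1 ->
      (k - mu 0 s - 1)%:~R * a 0 s
        - \sum_(j in S0plus a s S0 k) (mu 0 j)%:~R * a 0 j <= - a 0 i <= 0) ->
   facet_defining (fun p : wx_space R n => p.1)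
     (fun p => lifted_rhs f a mu s S0 S1 k p.2) (conv_hull (calX f a mu))).
Proof.
have valid : valid_ineq (fun p : wx_space R n => p.1)
    (fun p => lifted_rhs f a mu s S0 S1 k p.2) (calX f a mu).
  move=> p /(calX_vertex f a mu hmu)[z [zcap -> pf]]; apply: le_trans pf _.
  exact: lifted_valid.
split=> // small.
have [b [l hE]] := lifted_rhs_affine f a mu s S0 S1 k.
have hull_valid := conv_hull_valid _ _ _ hE _ valid.
split=> //.
have {}small i : i \in S1 -> (k - mu 0 s - 1)%:~R * a 0 s
    - \sum_(j in S0plus a s S0 k) (mu 0 j)%:~R * a 0 j <= - a 0 i.
  by move=> /small/andP[].
have tight := tight_vertices f a mu s S0 S1 k hf ha hmu has_pos hs0 hs1 hdisj hcover hk small.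
have [z hz] := choice tight.
have [z0cap z0tight] := mix_tight_s f a mu s S0 S1 k hf ha hmu has_pos hs0 hs1 hdisj
  hcover hk k (or_introl erefl).
set z0 := mix _ _ _ _ _ _ in z0cap z0tight.
have in_hull y : (forall i, (y i <= cap mu i)%N) ->
    conv_hull (calX f a mu) (vertex f a y).
  by move=> ycap; apply: sub_gen_smallest; exact: vertex_in_calX.
have zfree (c : 'I_n -> R) :
    \sum_i c i *: ((vertex f a (z i)).2 - (vertex f a z0).2) = 0 -> forall i, c i = 0.
  apply: (tight_vertices_free f a mu s S0 S1 k) => //; last by have [_ _ _ _ ->] := hz s.
  - by move=> i; have [] := hz i.
  - by move=> i; have [] := hz i.
pose q i := oapp (fun j => vertex f a (z j)) (vertex f a z0) (unlift ord0 i) : wx_space R n.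
have q_vertex (i : 'I_n.+1) : exists y, [/\ q i = vertex f a y,
    forall l, (y l <= cap mu l)%N & (vertex f a y).1
       = lifted_rhs f a mu s S0 S1 k (vertex f a y).2].
  rewrite /q; case: unlift => [j|] /=; last by exists z0.
  by have [zcap ztight _ _ _] := hz j; exists (z j).
have q_tight i : (q i).1 = lifted_rhs f a mu s S0 S1 k (q i).2.
  by have [y [-> _ ->]] := q_vertex i.
have q_hull i : conv_hull (calX f a mu) (q i).
  by have [y [-> ycap _]] := q_vertex i; exact: in_hull.
have qind : affinely_independent [tuple q i | i < n.+1].
  exact: affinely_independent_base.
(* The first coordinate is unbounded below in [calX], so lowering the base point by 1 gives a point
   of [calX] off the tight hyperplane. *)
pose p : wx_space R n := ((vertex f a z0).1 - 1, (vertex f a z0).2).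
have p_calX : calX f a mu p.
  have [v1 v2 v3] := vertex_in_calX f a mu hmu z0 z0cap; split=> //.
  by apply: le_trans v1; rewrite /= lerBlDr lerDl.
have p_off : p.1 != lifted_rhs f a mu s S0 S1 k p.2.
  by rewrite /= -z0tight lt_eqF // ltrBlDr ltrDl.
have pqind := affinely_independent_cons _ _ _ hE _ p q p_off q_tight qind.
(* With [p] there are [n + 2] independent points, the most the ambient space allows. *)
have hull_dim : affdim (conv_hull (calX f a mu)) = n.+2%:Z - 1.
  apply: (affdim_eq _ _ _ _ pqind) => // i.
  by rewrite tnth_mktuple; case: unlift => [j|] //=; exact: sub_gen_smallest.
(* The face lies on the graph of the right-hand side, so the [n + 1] points [q] are a largest
   independent family in it. *)
rewrite hull_dim [LHS](affdim_eq _ _ _ _ qind) //; last first.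
- move=> r t _ tind tA; apply: (affinely_independent_graph_le _ _ _ hE _ t tind).
  by move=> i; have [] := tA i.
- by move=> i; rewrite tnth_mktuple; split.
Qed.
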